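(* Fix $L\in \operatorname{GL}_{2d}(\mathbb{R})$ and let $\Theta_L = -L^TJL$, a real skew-symmetric $2d\times 2d$ matrix. The $2$-cocycle $\zeta_{\Theta_L^{\mathrm{low}}}$ is cohomologous to the $2$-cocycle $c_L$ by the $1$-cochain $\rho_L:\mathbb{Z}^{2d}\to \mathbb{T}$ given by $$\rho_L(k)=\exp\bigl(-\pi i\, k^T(L^TKL+\Theta^{\mathrm{low}}_L)k\bigr),\qquad k\in \mathbb{Z}^{2d};$$ that is, $$c_L(k,m) = \zeta_{\Theta^{\mathrm{low}}_L}(k,m)\,\frac{\rho_L(k+m)}{\rho_L(k)\rho_L(m)}, \qquad \text{for all } k,m\in \mathbb{Z}^{2d}.$$
   Context: Here $d\ge1$, $J=\begin{pmatrix}0&I_d\\-I_d&0\end{pmatrix}$, $K=\begin{pmatrix}0&I_d\\0&0\end{pmatrix}$ (real $2d\times 2d$ matrices), and $\mathbb{T}$ is the unit circle in $\mathbb{C}$. The Heisenberg cocycle on $\mathbb{R}^{2d}$ is $c(z_1,z_2)=e^{-2\pi i\,z_1^TKz_2}$, and $c_L(k,m)=c(Lk,Lm)$ for $k,m\in\mathbb{Z}^{2d}$. For a matrix $\Theta$, $\Theta^{\mathrm{low}}$ denotes the matrix that coincides with $\Theta$ strictly below the diagonal and is zero elsewhere. For a real $n\times n$ matrix $M$, $\zeta_M:\mathbb{Z}^n\times\mathbb{Z}^n\to\mathbb{T}$ is $\zeta_M(k,m)=e^{2\pi i\,k^TMm}$. Two $2$-cocycles $\zeta_1,\zeta_2:\mathbb{Z}^n\times\mathbb{Z}^n\to\mathbb{T}$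 are cohomologous if there is a map $\rho:\mathbb{Z}^n\to\mathbb{T}$ (a $1$-cochain) with $\zeta_1(k,m)=\zeta_2(k,m)\frac{\rho(k+m)}{\rho(k)\rho(m)}$ for all $k,m$. *)

(* Defs.v *)
From HB Require Import structures.
From mathcomp Require Import all_boot all_order all_algebra.
From mathcomp Require Import all_classical all_reals all_analysis.
From mathcomp Require Export complex.

Set Implicit Arguments.
Unset Strict Implicit.
Unset Printing Implicit Defensive.

Import Order.TTheory GRing.Theory Num.Theory.
Local Open Scope ring_scope.
Local Open Scope complex_scope.

Definition circle (R : realType) : Type := {z : R[i] | `|z| == 1}.

Definition circle_val (R : realType) (u : circle R) : R[i] := sval u.
Coercion circle_val : circle >-> complex.

Lemma norm_cos_sin (R : realType) (t : R) : `|(cos t +i* sin t : R[i])| == 1.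
Proof. by rewrite normc_def cos2Dsin2 sqrtr1. Qed.

(* e^(it), for real t. *)
Definition expi (R : realType) (t : R) : circle R :=
  exist _ (cos t +i* sin t : R[i]) (norm_cos_sin t).

Section Cocycles.
Variables (R : realType) (G : zmodType).

Definition cocycle2 (zeta : G -> G -> circle R) : Prop :=
  forall k m n : G,
    (zeta k m : R[i]) * zeta (k + m) n = (zeta k (m + n) : R[i]) * zeta m n.

Definition cohomologous_by (rho : G -> circle R)
    (zeta1 zeta2 : G -> G -> circle R) : Prop :=
  forall k m : G,
    (zeta1 k m : R[i]) =
    (zeta2 k m : R[i]) * ((rho (k + m) : R[i]) / ((rho k : R[i]) * rho m)).

End Cocycles.

Section Forms.
Variables (R : realType) (n : nat).

(* u^T M v as a scalar: the only entry of a 1 x 1 matrix. *)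
Definition bilin (M : 'M[R]_n) (u v : 'cV[R]_n) : R := (u^T *m M *m v) 0 0.

Definition toR (k : 'cV[int]_n) : 'cV[R]_n := map_mx intr k.

Definition low (M : 'M[R]_n) : 'M[R]_n :=
  \matrix_(i, j) if (j < i)%N then M i j else 0.

Definition zeta (M : 'M[R]_n) (k m : 'cV[int]_n) : circle R :=
  expi (2 * pi * bilin M (toR k) (toR m)).

End Forms.

Section Heisenberg.
Variables (R : realType) (d : nat).

Definition Jmx : 'M[R]_(d + d) := block_mx 0 1%:M (- 1%:M) 0.
Definition Kmx : 'M[R]_(d + d) := block_mx 0 1%:M 0 0.

Definition heisenberg (z1 z2 : 'cV[R]_(d + d)) : circle R :=
  expi (- (2 * pi * bilin Kmx z1 z2)).

Variable L : 'M[R]_(d + d).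

Definition heisenberg_lattice (k m : 'cV[int]_(d + d)) : circle R :=
  heisenberg (L *m toR R k) (L *m toR R m).

Definition Theta : 'M[R]_(d + d) := - (L^T *m Jmx *m L).

Definition rho (k : 'cV[int]_(d + d)) : circle R :=
  expi (- (pi * bilin (L^T *m Kmx *m L + low Theta) (toR R k) (toR R k))).

End Heisenberg.

(* Main.v *)
Require Import Defs.
From mathcomp Require Import all_boot all_order all_algebra.
From mathcomp Require Import all_classical all_reals all_analysis.
From mathcomp Require Import ring lra.

(** Every cochain in the statement is the exponential of [2 pi i] or [pi i]
    times a real bilinear expression, and [expi] turns sums into products, so
    all claims reduce to linear algebra on the exponents.  The cocycle identity
    becomes [b k m + b (k + m) n = b k (m + n) + b m n], which is immediate for
    biadditive [b].

    For the coboundary, put [A := L^T K L], [B := low Theta] and [S := A + B].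
    The chirp [k |-> exp (- pi i k^T S k)] has as coboundary the exponential of
    the polarization of its quadratic form, [- pi (k^T S m + m^T S k)].  The
    asserted identity therefore follows once [- 2 A = 2 B - (S + S^T)], that is,
    once [S] is symmetric.  It is: [K - K^T = J] gives [A - A^T = - Theta], while
    [B - B^T = Theta] because [Theta] is skew and hence has zero diagonal.  The
    real exponents thus agree exactly, not merely modulo [2 pi]; this is
    [twist_symmetric]. *)

Set Implicit Arguments.
Unset Strict Implicit.
Unset Printing Implicit Defensive.

Import Order.TTheory GRing.Theory Num.Theory.
Local Open Scope ring_scope.

Lemma expiD (R : realType) (s t : R) :
  (expi (s + t) : R[i]) = (expi s : R[i]) * expi t.
Proof.
rewrite /circle_val /= cosD sinD.
by apply/eqP; rewrite eq_complex /=; apply/andP; split; apply/eqP; ring.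
Qed.

Lemma circle_neq0 (R : realType) (u : circle R) : (u : R[i]) != 0.
Proof. by case: u => z /= /eqP z1; rewrite -normr_eq0 z1 oner_eq0. Qed.

Lemma cocycle2_expi (R : realType) (G : zmodType) (b : G -> G -> R) :
  (forall k l m, b (k + l) m = b k m + b l m) ->
  (forall k l m, b k (l + m) = b k l + b k m) ->
  cocycle2 (fun k m => expi (b k m)).
Proof.
by move=> bDl bDr k m n; rewrite -!expiD bDl bDr addrA.
Qed.

(** The hypothesis asks for equality of real exponents, which is stronger than
    their equality modulo [2 pi]; it is what the symmetry of the twist gives. *)
Lemma cohomologous_by_expi (R : realType) (G : zmodType)
    (q : G -> R) (b1 b2 : G -> G -> R) :
  (forall k m, b1 k m + (q k + q m) = b2 k m + q (k + m)) ->
  cohomologous_by (fun k => expi (q k))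
    (fun k m => expi (b1 k m)) (fun k m => expi (b2 k m)).
Proof.
move=> E k m; rewrite mulrA -!expiD -E expiD mulfK //.
exact: circle_neq0.
Qed.

Section Bilin.
Variables (R : realType) (n : nat).
Implicit Types (M N : 'M[R]_n) (u v w : 'cV[R]_n).

Lemma bilinDl M u v w : bilin M (u + v) w = bilin M u w + bilin M v w.
Proof. by rewrite /bilin linearD !mulmxDl mxE. Qed.

Lemma bilinDr M u v w : bilin M u (v + w) = bilin M u v + bilin M u w.
Proof. by rewrite /bilin mulmxDr mxE. Qed.

Lemma bilinDm M N u v : bilin (M + N) u v = bilin M u v + bilin N u v.
Proof. by rewrite /bilin mulmxDr mulmxDl mxE. Qed.

Lemma bilin_tr M u v : bilin M^T u v = bilin M v u.
Proof.
(* A 1 x 1 matrix equals its transpose. *)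
by rewrite /bilin -(trmxK (u^T *m _ *m v)) [LHS]mxE !trmx_mul !trmxK mulmxA.
Qed.

Lemma bilin_mulmx M N u v : bilin M (N *m u) (N *m v) = bilin (N^T *m M *m N) u v.
Proof. by rewrite /bilin trmx_mul !mulmxA. Qed.

Lemma toRD (k m : 'cV[int]_n) : toR R (k + m) = toR R k + toR R m.
Proof. by rewrite /toR map_mxD. Qed.

Lemma cocycle2_zeta M : cocycle2 (zeta M).
Proof.
by apply: cocycle2_expi => k l m; rewrite toRD ?bilinDl ?bilinDr mulrDr.
Qed.

Lemma skew_low M : M^T = - M -> low M - (low M)^T = M.
Proof.
move=> skewM; apply/matrixP => i j; rewrite !mxE.
have Mji : M j i = - M i j by move/matrixP/(_ i j): skewM; rewrite !mxE.
case: (ltngtP i j) => [_|_|/val_inj eij].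
- by rewrite Mji sub0r opprK.
- by rewrite subr0.
- by move: Mji; rewrite subr0 eij => Mjj; lra.
Qed.

End Bilin.

Section Twist.
Variables (R : realType) (d : nat) (L : 'M[R]_(d + d)).

Lemma Kmx_sub_tr : Kmx R d - (Kmx R d)^T = Jmx R d.
Proof.
rewrite /Kmx /Jmx tr_block_mx !trmx0 trmx1 opp_block_mx add_block_mx.
by rewrite !subr0 sub0r.
Qed.

Lemma Theta_pullback :
  Theta L = (L^T *m Kmx R d *m L)^T - L^T *m Kmx R d *m L.
Proof.
by rewrite /Theta -Kmx_sub_tr mulmxBr mulmxBl opprB !trmx_mul trmxK mulmxA.
Qed.

Lemma Theta_skew : (Theta L)^T = - Theta L.
Proof. by rewrite Theta_pullback linearB /= trmxK opprB. Qed.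

(** The quadratic form in [rho L] is built so that the skew part of [low Theta]
    cancels that of [L^T K L]. *)
Lemma twist_symmetric (S := L^T *m Kmx R d *m L + low (Theta L)) : S^T = S.
Proof.
apply/esym/eqP; rewrite -subr_eq0 /S linearD /= opprD addrACA.
by rewrite skew_low ?Theta_skew // Theta_pullback addrC subrKA subrr.
Qed.

Lemma cocycle2_heisenberg_lattice : cocycle2 (heisenberg_lattice L).
Proof.
apply: cocycle2_expi => k l m; rewrite toRD mulmxDr ?bilinDl ?bilinDr.
all: by rewrite mulrDr opprD.
Qed.

Lemma heisenberg_lattice_cohomologous :
  cohomologous_by (rho L) (heisenberg_lattice L) (zeta (low (Theta L))).
Proof.
apply: cohomologous_by_expi => k m.
rewrite toRD bilin_mulmx.
have := bilin_tr (L^T *m Kmx R d *m L + low (Theta L)) (toR R k) (toR R m).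
rewrite twist_symmetric => polar.
rewrite !bilinDl !bilinDr -polar !bilinDm; ring.
Qed.

End Twist.

Theorem lemma3p3 (R : realType) (d : nat) (hd : (0 < d)%N)
    (L : 'M[R]_(d + d)) (hL : L \in unitmx) :
  [/\ (Theta L)^T = - Theta L,
      cocycle2 (zeta (low (Theta L))),
      cocycle2 (heisenberg_lattice L)
    & cohomologous_by (rho L) (heisenberg_lattice L) (zeta (low (Theta L)))].
Proof.
split; [exact: Theta_skew | exact: cocycle2_zeta
  | exact: cocycle2_heisenberg_lattice | exact: heisenberg_lattice_cohomologous].
Qed.
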